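(* Let $p$ be an odd prime, $n$ a positive integer and $q=p^{2n}$. Let $s\ge 1$, let $a_1,\dots,a_s\in\mathbb{F}_q$, and let $t_1,\dots,t_s$ be positive integers with $t_i\mid n$ for all $i$. Let $d_1,\dots,d_s$ be positive integers and assume that for each $i=1,\dots,s$ there exists a divisor $r_i$ of $t_i$ such that $d_i\mid (p^{r_i}+1)$. Let $N$ be the number of tuples $(x_1,\dots,x_s)$ with $x_i\in\mathbb{F}_{p^{2t_i}}$ for all $i$ satisfying $$a_1x_1^{d_1}+\cdots+a_sx_s^{d_s}=0.$$ Then $$N=p^{t_1+\cdots+t_s-2n}\sum_{c\in\mathbb{F}_q}\prod_{i=1}^{s}\Delta(a_i,d_i,t_i,r_i,c).$$
   Context: For $m\mid n$, $\operatorname{tr}_{p^{2n},p^{2m}}$ denotes the trace map from $\mathbb{F}_{p^{2n}}$ to $\mathbb{F}_{p^{2m}}$. For $a\in\mathbb{F}_q$ and positive integers $d,t,r$ with $r\mid t$, $t\mid n$ and $d\mid (p^r+1)$, set $m=\frac{p^{2t}-1}{d}$, $u=\frac{p^r+1}{d}$, $\varepsilon=(-1)^{t/r}$ and $T(x)=\operatorname{tr}_{q,p^{2t}}(x)$, and for $c\in\mathbb{F}_q$ define $$\Delta(a,d,t,r,c)=\begin{cases}p^{t},&\text{if }T(ca)=0;\\ \varepsilon(1-d),&\text{if }T(ca)^{m}=\varepsilon^{u};\\ \varepsilon,&\text{if }T(ca)^m\notin\{0,\varepsilon^u\}.\end{cases}$$ *)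

(* Defs.v *)
From HB Require Import structures.
From mathcomp Require Import all_boot all_order all_algebra all_field.
Set Implicit Arguments. Unset Strict Implicit. Unset Printing Implicit Defensive.
Import Order.TTheory GRing.Theory Num.Theory.
Local Open Scope ring_scope.

(* Relative trace tr_{p^(2n), p^(2t)}(x) = sum_{j < n/t} x^(p^(2 t j)),
   for F a finite field of order q = p^(2n) and t | n. *)
Definition rtrace (F : finFieldType) (p n t : nat) (x : F) : F :=
  \sum_(j < n %/ t) x ^+ (p ^ (2 * t * j)).

Definition Delta (F : finFieldType) (p n : nat) (a : F) (d t r : nat) (c : F)
  : int :=
  let m := ((p ^ (2 * t)).-1 %/ d)%N in
  let u := ((p ^ r).+1 %/ d)%N in
  let epsZ : int := (-1) ^+ (t %/ r) in
  let epsF : F := (-1) ^+ (t %/ r) in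
  let T := rtrace p n t (c * a) in
  if T == 0 then (p ^ t)%:Z
  else if T ^+ m == epsF ^+ u then epsZ * (1 - d%:Z)
  else epsZ.

(* Main.v *)
Require Import Defs.
From HB Require Import structures.
From mathcomp Require Import all_boot all_order all_algebra.
From mathcomp Require Import all_solvable all_field.
From mathcomp Require Import ring zify.
Set Implicit Arguments. Unset Strict Implicit. Unset Printing Implicit Defensive.
Import Order.TTheory GRing.Theory Num.Theory.
Local Open Scope ring_scope.

(** Orthogonality of the additive characters of [F] reduces the count to the
    sums [S_d(T) = \sum_x psi(T x^d)] over the subfields [K] of order [Q^2],
    [Q = p^t], where [psi] is the trace character of [K] and [T] is the relative
    trace of [c a_i].
    For [d = q + 1], [q = p^r], the number [-1] is a [d]-th power in [K], so
    [S_d(T)^2 = S_d(T) S_d(-T)]; expanding [(x + y)^(q+1)] by the Frobenius shows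
    that this is [Q^2] times the number of zeros of the additive polynomial
    [T^q x^(q^2) + T x], which is [q^2] or [1]. The sign of [S_d(T)] follows from
    [S_d(T) = 1] modulo [q + 1] in the algebraic integers. No estimate of Gauss
    sums is needed, and the parity of [t / r] only enters through [Q = (-1)^(t/r)]
    modulo [q + 1].
    For a divisor [d] of [q + 1], [S_d(T)] is the average of [S_(q+1)(T g^d)] over
    the nonzero [g] in [K]. *)

(** * Power equations and Frobenius in finite fields *)

Lemma card_finField_pred_gt0 (K : finFieldType) : (0 < #|K|.-1)%N.
Proof.
by have := finNzRing_gt1 K; case: #|K| => [|[]].
Qed.

Lemma expf_card_pred (K : finFieldType) (x : K) : x != 0 -> x ^+ #|K|.-1 = 1.
Proof.
move=> x0; apply: (mulfI x0); rewrite mulr1 -exprS prednK ?expf_card //.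
by apply: ltnW; apply: finNzRing_gt1.
Qed.

Lemma finField_prim_root (K : finFieldType) :
  exists g : K, (#|K|.-1).-primitive_root g.
Proof.
have /hasP[g _ gP] : has (#|K|.-1).-primitive_root (enum (predC1 (0 : K))).
  apply: has_prim_root; rewrite ?enum_uniq ?card_finField_pred_gt0 //.
    apply/allP => x; rewrite mem_enum inE => x0.
    by apply/unity_rootP; rewrite expf_card_pred.
  by rewrite -cardE cardC1.
by exists g.
Qed.

(** The group of nonzero elements is cyclic, so [b] is a [k]-th power exactly when
    [b ^+ (#|K|.-1 %/ k) = 1]. The solutions then form a coset of the [k]-th roots of unity, of
    which there are [k] since [k] divides the group order. *)
Lemma card_expf_eq (K : finFieldType) (k : nat) (b : K) :
  (k %| #|K|.-1)%N -> b != 0 ->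
  #|[pred x : K | x ^+ k == b]| =
    if b ^+ (#|K|.-1 %/ k) == 1 then k else 0%N.
Proof.
move=> kN b0; have [g gP] := finField_prim_root K.
have N0 := card_finField_pred_gt0 K.
have k0 : (0 < k)%N by apply: dvdn_gt0 kN.
case: eqP => [bk1|bk1]; last first.
  apply: eq_card0 => x; rewrite !inE; apply/eqP => xkb; apply: bk1.
  have x0 : x != 0 by apply: contraNneq b0 => x0; rewrite -xkb x0 expr0n gtn_eqF.
  by rewrite -xkb -exprM mulnC divnK // expf_card_pred.
have [x0 x0k] : exists x, x ^+ k = b.
  have [i bi] := prim_rootP gP (expf_card_pred b0).
  have : (k %| i)%N.
    have := bk1; rewrite bi -exprM => /eqP; rewrite -(prim_order_dvd gP).
    by rewrite -{1}(divnK kN) mulnC dvdn_pmul2r // divn_gt0 // dvdn_leq.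
  by case/dvdnP => j ij; exists (g ^+ j); rewrite -exprM -ij.
have x00 : x0 != 0.
  by apply: contraNneq b0 => x00; rewrite -x0k x00 expr0n gtn_eqF.
have hP := dvdn_prim_root gP kN; set h := g ^+ _ in hP.
have inj : injective (fun i : 'I_k => x0 * h ^+ i).
  move=> i j /(mulfI x00) /eqP; rewrite (eq_prim_root_expr hP) !modn_small //.
  by move/eqP/val_inj.
rewrite -[RHS]card_ord -(card_codom inj); apply: eq_card => x.
rewrite !inE; apply/eqP/codomP => [xk|[i ->]].
  have [|i xi] := prim_rootP hP (x := x / x0).
    by rewrite expr_div_n xk x0k divff.
  by exists i; rewrite -xi mulrC divfK.
by rewrite exprMn x0k -exprM mulnC exprM (prim_expr_order hP) expr1n mulr1.
Qed.

Lemma exprD_pchar_exp (R : comNzRingType) (p k : nat) (x y : R) :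
  p \in [pchar R] -> (x + y) ^+ (p ^ k) = x ^+ (p ^ k) + y ^+ (p ^ k).
Proof.
move=> pR; apply: exprDn_pchar.
by rewrite pnatX (eq_pnat _ (pcharf_eq pR)) pnat_id ?(pcharf_prime pR).
Qed.

Lemma expf_pchar_inj (K : fieldType) (p k : nat) :
  p \in [pchar K] -> injective (fun x : K => x ^+ (p ^ k)).
Proof.
move=> pK x y xy; apply/eqP; rewrite -subr_eq0.
have : (x - y) ^+ (p ^ k) == 0.
  have E := exprD_pchar_exp k (x - y) y pK.
  by rewrite subrK xy in E; rewrite -(addrK (y ^+ (p ^ k)) (_ ^+ _)) -E subrr.
by rewrite expf_eq0 => /andP[].
Qed.

(** This fixes a sign from a congruence. If [S = - X], adding the two congruences gives
    [2 = - D (u + v)], and [2 / D] would be a rational algebraic integer strictly between 0 and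
    1. *)
Lemma Aint_sign_eq (S X : algC) (D : nat) :
  (2 < D)%N -> S ^+ 2 = X ^+ 2 ->
  (exists2 eta, eta \in Aint & S = 1 + D%:R * eta) ->
  (exists2 k, k \in Aint & X = 1 + D%:R * k) -> S = X.
Proof.
move=> D2 /eqP; rewrite eqf_sqr => /orP[/eqP //|/eqP SX] [u uA Su] [v vA Xv].
have D0 : (D%:R : algC) != 0 by rewrite pnatr_eq0; lia.
have : (2%:R / D%:R : algC) \in Aint.
  have -> : 2%:R / D%:R = - (u + v).
    apply: (mulIf D0); rewrite divfK //; apply/eqP; rewrite -subr_eq0; apply/eqP.
    transitivity ((1 + D%:R * u) + (1 + D%:R * v)); first by ring.
    by rewrite -Su -Xv SX addNr.
  by rewrite rpredN rpredD.
move/Cint_rat_Aint; rewrite rpred_div ?rpred_nat // => /(_ isT) /intrP [z zE].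
have z0 : (0 < z)%R.
  by rewrite -(ltr0z algC) -zE divr_gt0 ?ltr0n //; lia.
have z1 : (z < 1)%R.
  by rewrite -(ltrz1 algC) -zE ltr_pdivrMr ?ltr0n ?mul1r ?ltr_nat //; lia.
by move: z0 z1; lia.
Qed.

(** * Power sums of a nontrivial Frobenius-invariant additive character *)

Section GaussSum.

Variables (K : finFieldType) (p : nat) (psi : K -> algC).
Hypotheses (pK : p \in [pchar K]) (p_odd : odd p).
Hypothesis psiD : {morph psi : x y / x + y >-> x * y}.
Hypothesis psi_p1 : forall x, psi x ^+ p = 1.
Hypothesis psi_frob : forall x, psi (x ^+ p) = psi x.
Hypothesis psi_nontriv : exists z, psi z != 1.

Let p_gt0 : (0 < p)%N. Proof. exact/prime_gt0/(pcharf_prime pK). Qed.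

Lemma psi_neq0 x : psi x != 0.
Proof.
apply/eqP => x0; have := psi_p1 x.
by rewrite x0 expr0n gtn_eqF // => /eqP; rewrite eq_sym oner_eq0.
Qed.

Lemma psi_0 : psi 0 = 1.
Proof. by apply: (mulfI (psi_neq0 0)); rewrite -psiD addr0 mulr1. Qed.

Lemma psi_Aint x : psi x \in Aint.
Proof. by apply: (Aint_unity_root p_gt0); apply/unity_rootP. Qed.

Lemma psi_frobX k x : psi (x ^+ (p ^ k)) = psi x.
Proof. by elim: k => // k IH; rewrite expnSr exprM psi_frob. Qed.

(** Frobenius invariance gives [psi z = psi (- z)], so [psi z] is a square root of 1. It is also a
    [p]-th root of unity with [p] odd, hence 1. *)
Lemma psi_antifixed k z : z ^+ (p ^ k) = - z -> psi z = 1.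
Proof.
move=> zN; have sq : psi z ^+ 2 = 1.
  by rewrite expr2 -{1}(psi_frobX k) zN -psiD addNr psi_0.
have := psi_p1 z; rewrite -(odd_double_half p) p_odd -mul2n exprD exprM sq.
by rewrite expr1n mulr1.
Qed.

(** For nonzero [w] the sum is that of [psi] over [K]; translating by some [z] with [psi z != 1]
    multiplies it by [psi z], so it vanishes. *)
Lemma sum_psi_mul w : \sum_y psi (w * y) = if w == 0 then #|K|%:R else 0.
Proof.
case: eqP => [->|/eqP w0].
  by under eq_bigr do rewrite mul0r psi_0; rewrite sumr_const.
rewrite -(reindex_inj (mulfI w0) (F := psi) (P := xpredT)) /=.
have [z z1] := psi_nontriv.
suff /eqP : (psi z - 1) * \sum_y psi y = 0.
  by rewrite mulf_eq0 subr_eq0 (negPf z1) => /eqP.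
rewrite mulrBl mul1r mulr_sumr [X in _ - X](reindex_inj (addrI z)) /=.
by apply/eqP; rewrite subr_eq0; apply/eqP; apply: eq_bigr => y _; rewrite psiD.
Qed.

Variables (r e : nat).
Hypotheses (r_gt0 : (0 < r)%N) (cardK : #|K| = (p ^ (2 * (r * e)))%N).

Let q := (p ^ r)%N.
Let Q := (p ^ (r * e))%N.
Let D := q.+1.
Let N := #|K|.-1.
(** The ring is left open because the sign occurs in [K], in the power residue condition, and in
    [algC], in the value of the sum. *)
Let eps {R : pzRingType} : R := (-1) ^+ e.

Definition powersum d T := \sum_x psi (T * x ^+ d).

Let p_ge3 : (2 < p)%N.
Proof. by have := prime_gt1 (pcharf_prime pK); case: p p_odd => [|[|[|]]]. Qed.

Let q_odd : odd q. Proof. by rewrite oddX p_odd orbT. Qed.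

Let q_ge3 : (2 < q)%N.
Proof. by apply: leq_trans p_ge3 _; rewrite -{1}(expn1 p) leq_exp2l; lia. Qed.

(** The geometric series for [(#|K| - 1) / (q^2 - 1)]; it has [e] odd terms, hence the parity of
    [e]. *)
Let L := (\sum_(i < e) (q ^ 2) ^ i)%N.

Let NE : N = ((q ^ 2).-1 * L)%N.
Proof. by rewrite /N cardK -predn_exp -!expnM; do 2 f_equal; lia. Qed.

Let qD : (q ^ 2).-1 = (D * q.-1)%N.
Proof. by rewrite /D; move: q q_ge3 => [|x]; nia. Qed.

Let N_gt0 : (0 < N)%N := card_finField_pred_gt0 K.
Let ND : (D %| N)%N. Proof. by rewrite NE qD -mulnA dvdn_mulr. Qed.
Let ND_E : (N %/ D = q.-1 * L)%N.
Proof. by rewrite NE qD -mulnA mulKn. Qed.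

Let oddL : odd L = odd e.
Proof.
rewrite /L; elim: e => [|k IH]; first by rewrite big_ord0.
by rewrite big_ord_recr /= oddD IH !oddX p_odd !orbT addbT.
Qed.

(** Since [N / D = (q - 1) L] is even, [-1] is a [D]-th power [w ^+ D], and the substitution of
    [w x] for [x] changes the sign of [T]. *)
Lemma powersumN T : powersum D (- T) = powersum D T.
Proof.
have : (0 < #|[pred x : K | (x ^+ D == -1)%R]|)%N.
  rewrite card_expf_eq ?oppr_eq0 ?oner_eq0 // ND_E exprM -signr_odd.
  have -> : odd q.-1 = false by move: q_odd q_ge3; case: (q) => //= x /negPf ->.
  by rewrite expr0 expr1n eqxx.
case/card_gt0P => w; rewrite inE => /eqP wD.
have w0 : w != 0.
  by apply/eqP => w0; move/eqP: wD; rewrite w0 expr0n eq_sym oppr_eq0 oner_eq0.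
rewrite /powersum (reindex_inj (mulfI w0)) /=; apply: eq_bigr => x _.
by rewrite exprMn wD mulN1r mulrNN.
Qed.

Lemma powersum_sqr_card T :
  powersum D T ^+ 2 =
    #|K|%:R * #|[pred x : K | T ^+ q * x ^+ (q ^ 2) + T * x == 0]|%:R.
Proof.
rewrite expr2 -{2}powersumN /powersum mulr_suml.
under eq_bigr do rewrite mulr_sumr.
rewrite exchange_big /=.
transitivity (\sum_y \sum_x psi (T * x ^+ D) *
                psi ((T ^+ q * x ^+ (q ^ 2) + T * x) * y ^+ q)).
  (* After the shift of [x] by [y], the term in [y^(q+1)] cancels. Replacing [T x^q y] by its [q]-th
     power under [psi] makes all remaining dependence on [y] a multiple of [y^q]. *)
  apply: eq_bigr => y _; rewrite (reindex_inj (addIr y)) /=; apply: eq_bigr => x _.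
  have -> : psi (T * (x + y) ^+ D) * psi (- T * y ^+ D) =
            psi (T * x ^+ D) * psi (T * x ^+ q * y) * psi (T * x * y ^+ q).
    by rewrite -!psiD /D !exprS (exprD_pchar_exp r x y pK); congr psi; ring.
  rewrite -mulrA -(psi_frobX r (T * x ^+ q * y)) -!psiD; congr (psi (_ + _)).
  by rewrite !exprMn -!exprM mulnn; ring.
rewrite exchange_big /=.
transitivity (\sum_(x | T ^+ q * x ^+ (q ^ 2) + T * x == 0) (#|K|%:R : algC)).
  rewrite [RHS]big_mkcond /=; apply: eq_bigr => x _; rewrite -mulr_sumr.
  (* Frobenius is a bijection of [K], so [y] may stand for [y^q], and orthogonality keeps only the
     [x] in the kernel. *)
  rewrite -(reindex_inj (expf_pchar_inj (k := r) pK) (P := xpredT)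
             (F := fun y => psi ((T ^+ q * x ^+ (q ^ 2) + T * x) * y))) /=.
  rewrite sum_psi_mul; case: eqP => [x0|_]; last by rewrite mulr0.
  (* For [x] in the kernel, [z = T x^(q+1)] satisfies [z^q = - z], so its character value is 1. *)
  rewrite (@psi_antifixed r) ?mul1r // exprMn -exprM -/q.
  rewrite [(D * q)%N]mulSn exprD [T ^+ q * _]mulrC.
  have -> : x ^+ q * x ^+ (q * q) * T ^+ q = x ^+ q * (T ^+ q * x ^+ (q ^ 2)).
    by rewrite mulnn; ring.
  by rewrite -[T ^+ q * _]opprK (addr0_eq x0) /D exprS; ring.
by rewrite sumr_const mulr_natr.
Qed.

(** Besides 0, the zeros are the solutions of [x^(q^2-1) = b] with [b = - T^(1-q)]. There are
    [q^2 - 1] of them if [b^L = 1] and none otherwise; as [L] has the parity of [e], this condition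
    reads [T^(N/D) = (-1)^e]. *)
Lemma card_powersum_kernel T : T != 0 ->
  #|[pred x : K | T ^+ q * x ^+ (q ^ 2) + T * x == 0]| =
    if T ^+ (N %/ D) == eps then (q ^ 2)%N else 1%N.
Proof.
move=> T0; have q1 : (0 < q ^ 2)%N by rewrite expn_gt0 (ltn_trans _ q_ge3).
have q2_pred_gt0 : (0 < (q ^ 2).-1)%N.
  by rewrite -subn1 subn_gt0 -[1%N](exp1n 2) ltn_exp2r // (ltn_trans _ q_ge3).
pose b := - (T ^+ q.-1)^-1.
have b0 : b != 0 by rewrite oppr_eq0 invr_eq0 expf_neq0.
rewrite (cardD1 0) inE /= expr0n gtn_eqF // !mulr0 addr0 eqxx.
have -> : #|[predD1 [pred x | T ^+ q * x ^+ (q ^ 2) + T * x == 0] & 0]| =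
          #|[pred x | x ^+ (q ^ 2).-1 == b]|.
  apply: eq_card => x; rewrite !inE.
  have [->|x0] /= := eqVneq x 0.
    rewrite expr0n -[_ == 0%N]negbK -lt0n eq_sym.
    by rewrite q2_pred_gt0 (negPf b0).
  rewrite -{1}(prednK q1) -{1}(prednK (ltnW (ltnW q_ge3))) !exprS.
  have -> : T * T ^+ q.-1 * (x * x ^+ (q ^ 2).-1) + T * x =
            T * x * T ^+ q.-1 * (x ^+ (q ^ 2).-1 - b).
    by rewrite /b opprK mulrDr mulfK ?expf_neq0 //; ring.
  by rewrite mulf_eq0 subr_eq0 !mulf_eq0 (negPf T0) (negPf x0) expf_eq0
    (negPf T0) andbF.
rewrite card_expf_eq // -/N; last by rewrite NE dvdn_mulr.
rewrite {1}NE mulKn //.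
have -> : (b ^+ L == 1) = (T ^+ (N %/ D) == eps).
  rewrite /b exprNn exprVn -exprM -ND_E -signr_odd oddL signr_odd -/eps.
  rewrite -(inj_eq (mulIf (expf_neq0 (N %/ D) T0))) mulfVK ?expf_neq0 // mul1r.
  by rewrite eq_sym.
by case: ifP; rewrite //= add1n prednK.
Qed.

(** The term at 0 is 1. The nonzero [x] are grouped by the value of [x ^+ d], and every nonempty
    fibre has exactly [d] elements. *)
Lemma powersum_modD (T : K) (d : nat) : (d %| N)%N ->
  exists2 eta, eta \in Aint & powersum d T = 1 + d%:R * eta.
Proof.
move=> dN; have d0 : (0 < d)%N by apply: dvdn_gt0 dN.
pose P := [pred b : K | (b != 0) && (b ^+ (N %/ d) == 1)].
exists (\sum_(b | P b) psi (T * b)).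
  by apply: rpred_sum => b _; apply: psi_Aint.
rewrite /powersum (bigD1 0) //= expr0n gtn_eqF // mulr0 psi_0; congr (_ + _).
rewrite (partition_big (fun x => x ^+ d) (fun b => b != 0)) => [|x];
  last exact: expf_neq0.
rewrite mulr_sumr [LHS](eq_bigr (fun b => (d * (b ^+ (N %/ d) == 1))%:R * psi (T * b))).
  rewrite [RHS]big_mkcondr /=; apply: eq_bigr => b _.
  by case: eqP => _; rewrite ?muln1 // muln0 mul0r.
move=> b b0; rewrite (eq_bigr (fun=> psi (T * b))) => [|x /andP[_ /eqP-> //]].
rewrite sumr_const -[LHS]mulr_natl; congr (_%:R * _).
transitivity #|[pred x : K | x ^+ d == b]|.
  apply: eq_card => x; rewrite !inE unfold_in /=.
  case: (x ^+ d =P b) => [xb|]; rewrite ?andbF // andbT.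
  by apply: contraNneq b0 => x0; rewrite -xb x0 expr0n gtn_eqF.
by rewrite card_expf_eq //; case: ifP; rewrite ?muln1 ?muln0.
Qed.

(** Since [q] is [-1] modulo [D = q + 1], its power [Q = q^e] is [(-1)^e]. *)
Let epsQ_modD : exists2 k : algC, k \in Aint & eps * Q%:R = 1 + D%:R * k.
Proof.
suff : exists z : int, (-1) ^+ e * Q%:Z = 1 + D%:Z * z.
  case=> z E; exists z%:~R; first by rewrite Aint_Cint ?intr_int.
  have := congr1 (fun x : int => x%:~R : algC) E.
  by rewrite /= rmorphM rmorphXn rmorphN rmorph1 rmorphD rmorphM /= rmorph1.
rewrite /Q expnM -/q; elim: e => [|k [z IH]]; first by exists 0; rewrite mulr0.
exists (z - (-1) ^+ k * (q ^ k)%N%:Z).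
have DE : D%:Z = 1 + q%:Z by rewrite /D; lia.
rewrite DE in IH *.
rewrite exprS expnS PoszM.
have -> : -1 * (-1) ^+ k * (q%:Z * (q ^ k)%N%:Z) = 
 - q%:Z * ((-1) ^+ k * (q ^ k)%N%:Z) by ring.
by rewrite IH; ring.
Qed.

(** Both sides have the same square, by the kernel count, and both are 1 modulo [D > 2], so
    [Aint_sign_eq] identifies them. *)
Lemma powersumE T : T != 0 ->
  powersum D T = eps * Q%:R * (1 - (D * (T ^+ (N %/ D) == eps))%:R).
Proof.
move=> T0; have [k kA kE] := epsQ_modD.
apply: (@Aint_sign_eq _ _ D).
- exact: ltnW q_ge3.
- rewrite powersum_sqr_card card_powersum_kernel // !exprMn sqrr_sign mul1r.
  rewrite cardK mulnC expnM -/Q natrX; congr (_ * _); case: eqP => _.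
    have -> : 1 - (D * true)%:R = - q%:R :> algC by rewrite muln1 /D -natr1; ring.
    by rewrite sqrrN natrX.
  by rewrite muln0 subr0 expr1n.
- exact: powersum_modD.
- rewrite kE; exists (k - (T ^+ (N %/ D) == eps)%:R * (1 + D%:R * k)).
    apply: rpredB => //; apply: rpredM; first exact: rpred_nat.
    by apply: rpredD; [exact: rpred1 | apply: rpredM => //; exact: rpred_nat].
  by rewrite natrM; ring.
Qed.

Lemma powersum_dvdE d T : T != 0 -> (d %| D)%N ->
  powersum d T = eps * Q%:R * (1 - (d * (T ^+ (N %/ d) == eps ^+ (D %/ d)))%:R).
Proof.
move=> T0 dD.
have d0 : (0 < d)%N by apply: dvdn_gt0 dD.
set u := (D %/ d)%N; have Du : D = (u * d)%N by rewrite divnK.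
have u0 : (0 < u)%N by move: Du; rewrite /D; case: (u).
set M := (N %/ D)%N; have NM : N = (M * D)%N by rewrite divnK.
have M0 : (0 < M)%N by move: N_gt0; rewrite NM; case: (M).
have Nd : (N %/ d = M * u)%N by rewrite NM Du mulnA mulnK.
have Nn0 : (N%:R : algC) != 0 by rewrite pnatr_eq0 -lt0n.
apply: (mulfI Nn0).
(* The substitution [g -> g x^(D / d)] makes the inner sum independent of [x]. *)
transitivity (\sum_(g | g != 0) powersum D (T * g ^+ d)).
  rewrite [in RHS]/powersum exchange_big [RHS](bigD1 0) //=.
  rewrite [X in _ = X + _](eq_bigr (fun=> 1)) => [|g _]; last first.
    by rewrite expr0n /= mulr0 psi_0.
  rewrite sumr_const.
  rewrite [X in _ = _ + X](eq_bigr (fun=> \sum_(g | g != 0) psi (T * g ^+ d)))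
    => [|x x0]; last first.
    have xu := expf_neq0 u x0.
    rewrite [RHS](reindex_inj (mulIf xu)) /=.
    apply: eq_big => [g|g _]; first by rewrite mulf_eq0 (negPf xu) orbF.
    by rewrite exprMn -exprM -Du mulrA.
  rewrite sumr_const.
  have -> : #|[pred x : K | x != 0]| = N by rewrite /N -(cardC1 (0 : K)).
  rewrite /powersum -[X in _ = _ + X]mulr_natl (bigD1 (0 : K)) //=.
  by rewrite expr0n gtn_eqF // mulr0 psi_0 mulrDr mulr1.
(* With the closed form inserted for every nonzero [g], it remains to count the [g] with
   [g^(d M) = eps / T^M]. *)
rewrite (eq_bigr (fun g => eps * Q%:R *
  (1 - (D * (g ^+ (d * M) == eps / T ^+ M))%:R))) => [|g g0]; last first.
  rewrite powersumE ?mulf_neq0 ?expf_neq0 //; do 5 f_equal.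
  rewrite -/M exprMn -exprM -(inj_eq (mulfI (expf_neq0 M T0)) (g ^+ _)) [_ / _]mulrC.
  by rewrite mulVKf ?expf_neq0.
rewrite -mulr_sumr mulrCA; congr (_ * _).
rewrite sumrB sumr_const mulrBr mulr1.
have -> : #|[pred x : K | x != 0]| = N by rewrite /N -(cardC1 (0 : K)).
congr (_ - _).
rewrite -natr_sum -natrM; congr (_%:R).
rewrite -big_distrr /=.
have b0 : eps / T ^+ M != 0.
  by rewrite mulf_neq0 ?invr_eq0 ?expf_neq0 // oppr_eq0 oner_eq0.
transitivity (D * #|[pred g : K | g ^+ (d * M) == eps / T ^+ M]|)%N.
  congr (_ * _)%N; rewrite -sum1_card big_mkcond [RHS]big_mkcond /=.
  apply: eq_bigr => g _; rewrite inE; have [->|//] := eqVneq g 0.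
  by rewrite expr0n gtn_eqF ?muln_gt0 ?d0 // eq_sym (negPf b0).
(* As [d M] divides [N] with quotient [u], there are [d M] solutions if [(eps / T^M)^u = 1], that is
   [T^(N/d) = eps^u], and none otherwise. Multiplied by [D], the count [d M] becomes [N d]. *)
have NdM : N = (u * (d * M))%N by rewrite NM Du; lia.
rewrite card_expf_eq // -/N {1}NdM; last exact: dvdn_mull.
rewrite mulnK ?muln_gt0 ?d0 // Nd exprM.
rewrite expr_div_n -(inj_eq (mulIf (expf_neq0 u (expf_neq0 M T0)))).
rewrite divfK ?expf_neq0 // mul1r eq_sym.
by case: ifP => _; rewrite ?muln0 // ?muln1 NM; lia.
Qed.
End GaussSum.

(** * Subfields as fixed points of powers of Frobenius *)

Definition frob_fixed (F : finFieldType) (p : nat) (pF : p \in [pchar F])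
  (k : nat) : pred F := fun x => x ^+ (p ^ k) == x.

Lemma frob_fixed_divring_closed (F : finFieldType) (p : nat)
  (pF : p \in [pchar F]) (k : nat) : divring_closed (frob_fixed pF k).
Proof.
split=> [|x y|x y]; rewrite !unfold_in ?expr1n //.
- move=> /eqP xk /eqP yk; apply/eqP; apply: (addIr y).
  by rewrite -{2}yk -exprD_pchar_exp // !subrK.
- by move=> /eqP xk /eqP yk; rewrite expr_div_n xk yk.
Qed.

HB.instance Definition _ (F : finFieldType) (p : nat) (pF : p \in [pchar F])
  (k : nat) := GRing.isDivringClosed.Build F (frob_fixed pF k)
    (frob_fixed_divring_closed pF k).

(* The proof [pF] is a parameter so that the field structure on the type can
   be inferred. *)
Definition fixed_subfield (F : finFieldType) (p : nat) (pF : p \in [pchar F])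
  (k : nat) := {x : F | x \in frob_fixed pF k}.

Section FixedSubfield.

Variables (F : finFieldType) (p : nat) (pF : p \in [pchar F]) (k : nat).

HB.instance Definition _ := [isSub of fixed_subfield pF k for val].
HB.instance Definition _ := [Finite of fixed_subfield pF k by <:].
HB.instance Definition _ :=
  [SubChoice_isSubIntegralDomain of fixed_subfield pF k by <:].
HB.instance Definition _ :=
  [SubIntegralDomain_isSubField of fixed_subfield pF k by <:].

Lemma fixed_subfieldP (x : fixed_subfield pF k) : val x ^+ (p ^ k) = val x.
Proof. exact/eqP/(valP x). Qed.

Lemma pchar_fixed_subfield : p \in [pchar (fixed_subfield pF k)].
Proof. by rewrite -(fmorph_pchar val). Qed.

Lemma big_fixed_subfield (G : F -> algC) :
  \sum_(x | x ^+ (p ^ k) == x) G x = \sum_(x : fixed_subfield pF k) G (val x).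
Proof. by rewrite -big_sub. Qed.

(** The nonzero fixed points are the roots of unity of order dividing [p^k - 1], and [p^k - 1]
    divides [p^l - 1] because [k] divides [l]. *)
Lemma card_fixed_subfield (l : nat) : (0 < k)%N -> #|F| = (p ^ l)%N ->
  (k %| l)%N -> #|(fixed_subfield pF k : finFieldType)| = (p ^ k)%N.
Proof.
move=> k0 cardF /dvdnP[c lc].
have p1 := prime_gt1 (pcharf_prime pF).
have pk1 : (1 < p ^ k)%N by rewrite -(expn0 p) ltn_exp2l.
rewrite card_sig (cardD1 0) inE /= rpred0.
have -> : #|[predD1 [pred x | x \in frob_fixed pF k] & 0]| =
          #|[pred x : F | x ^+ (p ^ k).-1 == 1]|.
  apply: eq_card => x; rewrite !inE unfold_in /=.
  have [->|x0] /= := eqVneq x 0.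
    by rewrite expr0n eqn0Ngt -subn1 subn_gt0 pk1 eq_sym oner_eq0.
  rewrite -{1}(prednK (ltnW pk1)) exprS -{3}[x]mulr1.
  by rewrite (inj_eq (mulfI x0)).
rewrite card_expf_eq ?oner_eq0 // ?expr1n ?eqxx ?add1n ?prednK //; first exact: ltnW.
by rewrite cardF lc mulnC expnM [X in (_ %| X)%N]predn_exp dvdn_mulr.
Qed.

End FixedSubfield.

(** * Traces as sums of Frobenius conjugates, and characters of the prime field *)

Definition frob_sum (R : pzSemiRingType) (p k N : nat) (x : R) : R :=
  \sum_(j < N) x ^+ (p ^ (k * j)).

Section FrobeniusSum.

Variables (F : finFieldType) (p : nat) (pF : p \in [pchar F]).

Lemma sum_pchar_exp (I : Type) (s : seq I) (G : I -> F) (k : nat) :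
  (\sum_(i <- s) G i) ^+ (p ^ k) = \sum_(i <- s) G i ^+ (p ^ k).
Proof.
apply: (big_morph (fun x => x ^+ (p ^ k))) => [x y|].
  exact: exprD_pchar_exp.
by rewrite expr0n expn_eq0 eqn0Ngt (prime_gt0 (pcharf_prime pF)).
Qed.

Lemma frob_sumD k N : {morph @frob_sum F p k N : x y / x + y}.
Proof.
move=> x y; rewrite /frob_sum -big_split /=; apply: eq_bigr => j _.
exact: exprD_pchar_exp.
Qed.

Lemma frob_sum_exp k N (x : F) :
  frob_sum p k N (x ^+ p) = frob_sum p k N x ^+ p.
Proof.
rewrite -[in RHS](expn1 p) /frob_sum sum_pchar_exp expn1.
by apply: eq_bigr => j _; rewrite -!exprM mulnC.
Qed.

(** The power [p^k] shifts the conjugates by one place, and the last one wraps around to [x]. Thus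
    the trace lands in the subfield. *)
Lemma frob_sum_fixed k N (x : F) : x ^+ (p ^ (k * N)) = x ->
  frob_sum p k N x ^+ (p ^ k) = frob_sum p k N x.
Proof.
move=> xN; rewrite /frob_sum sum_pchar_exp.
case: N xN => [|N] xN; first by rewrite !big_ord0.
rewrite big_ord_recr [RHS]big_ord_recl /= muln0 expn0 expr1 addrC.
rewrite -exprM -expnD addnC -mulnS xN; congr (_ + _); apply: eq_bigr => j _.
by rewrite -exprM -expnD addnC -mulnS.
Qed.

Lemma expf_frob_fixed (k j : nat) (c : F) :
  c ^+ (p ^ k) = c -> c ^+ (p ^ (k * j)) = c.
Proof.
move=> ck; elim: j => [|j IH]; first by rewrite muln0 expn0 expr1.
by rewrite mulnS expnD exprM ck.
Qed.

Lemma frob_sumZ k N (c x : F) : c ^+ (p ^ k) = c ->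
  frob_sum p k N (c * x) = c * frob_sum p k N x.
Proof.
move=> ck; rewrite /frob_sum mulr_sumr; apply: eq_bigr => j _.
by rewrite exprMn (expf_frob_fixed j ck).
Qed.

(** Transitivity of the trace: each exponent below [k N] is uniquely [i + k j] with [i < k] and
    [j < N]. *)
Lemma frob_sum_comp k N (x : F) :
  frob_sum p 1 k (frob_sum p k N x) = frob_sum p 1 (k * N) x.
Proof.
rewrite /frob_sum; under eq_bigr do rewrite sum_pchar_exp.
rewrite exchange_big /= -(big_mkord xpredT (fun j => x ^+ (p ^ (1 * j)))).
rewrite [in RHS]mulnC big_nat_mul big_mkord; apply: eq_bigr => j _.
rewrite -[X in _ = \sum_(X <= _ < _) _]add0n big_addn mulSn addnK big_mkord.
apply: eq_bigr => i _.
by rewrite -exprM -expnD !mul1n mulnC addnC.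
Qed.

(** The [p] distinct images of [0, ..., p - 1] are roots of [X^p - X]; a further root [z] would
    exceed the degree. *)
Lemma fixed_natr (z : F) : z ^+ p = z -> exists2 i, (i < p)%N & z = i%:R.
Proof.
have p1 := prime_gt1 (pcharf_prime pF).
move=> zp; pose rs := [seq i%:R : F | i <- iota 0 p].
have [/mapP[i] | zrs] := boolP (z \in rs).
  by rewrite mem_iota => /andP[_ ip] ->; exists i.
have szP : size ('X^p - 'X : {poly F}) = p.+1.
  by rewrite size_polyDl size_polyXn // size_polyN size_polyX.
have P0 : ('X^p - 'X : {poly F}) != 0 by rewrite -size_poly_eq0 szP.
have := @max_poly_roots _ _ (z :: rs) P0; rewrite szP /= size_map size_iota.
rewrite ltnn => H; have : false; last by [].
apply: H.
  rewrite rootE !hornerE zp subrr eqxx /=; apply/allP => _ /mapP[i _ ->].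
  rewrite rootE !hornerE subr_eq0 -(pFrobenius_autE pF).
  by rewrite pFrobenius_aut_nat.
rewrite zrs map_inj_in_uniq ?iota_uniq // => i j; rewrite !mem_iota /= !add0n.
wlog ij : i j / (i <= j)%N => [H ip jp E|].
  by case/orP: (leq_total i j) => h; [|symmetry]; apply: H.
move=> _ jp /esym/eqP; rewrite -subr_eq0 -natrB // -(dvdn_pcharf pF) => pd.
apply/eqP; rewrite eqn_leq ij /= -subn_eq0; case: posnP pd => // h.
by move/(dvdn_leq h); rewrite leqNgt (leq_ltn_trans (leq_subr _ _)).
Qed.

(* [i%:R] is sent to [zeta ^+ i]; elements outside the prime field get [1]. *)
Definition prime_field_char (zeta : algC) (z : F) : algC :=
  zeta ^+ (odflt ord0 [pick i : 'I_p.+1 | i%:R == z]).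

Variables (zeta : algC) (zetaP : p.-primitive_root zeta).

(** The representative found by [pick] may differ from [i] by a multiple of [p], which [zeta] does
    not see. *)
Lemma prime_field_char_natr (i : nat) :
  prime_field_char zeta i%:R = zeta ^+ i.
Proof.
have p0 := prime_gt0 (pcharf_prime pF).
have natE (a b : nat) : (a%:R == b%:R :> F) -> zeta ^+ a = zeta ^+ b.
  wlog ab : a b / (a <= b)%N => [H E|].
    by case/orP: (leq_total a b) => h; [|symmetry]; apply: H; rewrite // eq_sym.
  rewrite eq_sym -subr_eq0 -natrB // -(dvdn_pcharf pF) (prim_order_dvd zetaP).
  by move/eqP => E; rewrite -(subnK ab) exprD E mul1r.
rewrite /prime_field_char; case: pickP => [j /natE //|/= H].
have imp : (i %% p < p.+1)%N by rewrite ltnS ltnW // ltn_mod.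
have := H (Ordinal imp); rewrite /= {2}(divn_eq i p) natrD natrM (pcharf0 pF).
by rewrite mulr0 add0r eqxx.
Qed.

Lemma prime_field_charD (y z : F) : y ^+ p = y -> z ^+ p = z ->
  prime_field_char zeta (y + z) =
  prime_field_char zeta y * prime_field_char zeta z.
Proof.
move=> /fixed_natr[i _ ->] /fixed_natr[j _ ->].
by rewrite -natrD !prime_field_char_natr exprD.
Qed.

Lemma prime_field_char_eq1 (z : F) : z ^+ p = z ->
  (prime_field_char zeta z == 1) = (z == 0).
Proof.
move=> /fixed_natr[i _ ->]; rewrite prime_field_char_natr.
by rewrite -(prim_order_dvd zetaP) (dvdn_pcharf pF).
Qed.

Lemma prime_field_char_expp (z : F) : prime_field_char zeta z ^+ p = 1.
Proof.
by rewrite /prime_field_char -exprM mulnC exprM (prim_expr_order zetaP) expr1n.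
Qed.

(** * The trace character of a fixed subfield *)

Section TraceChar.

Variables (k l : nat).
Hypotheses (k_gt0 : (0 < k)%N) (cardF : #|F| = (p ^ l)%N) (kl : (k %| l)%N).

(** The trace is given by a polynomial of degree at most [p^(k-1)], too small to vanish on all [p^k]
    elements. It is nonzero because its coefficient at [X] is 1. *)
Lemma exists_frob_sum_neq0 :
  exists z : fixed_subfield pF k, frob_sum p 1 k (val z) != 0.
Proof.
have p1 := prime_gt1 (pcharf_prime pF).
apply/existsP; apply: contraTT isT; rewrite negb_exists => /forallP all0.
pose P : {poly F} := \sum_(j < k) 'X^(p ^ (1 * j)).
have P0 : P != 0.
  apply: contraTneq (oner_neq0 F) => PE; rewrite negbK; apply/eqP.
  have := coef0 F 1; rewrite -PE /P coef_sum; case: (k) k_gt0 => // m _.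
  rewrite big_ord_recl /= coefXn muln0 expn0 eqxx big1 ?addr0 // => i _.
  rewrite coefXn mul1n ltn_eqF //.
  by rewrite -(expn0 p) ltn_exp2l.
have szP : (size P <= (p ^ k.-1).+1)%N.
  apply: (leq_trans (size_sum _ _ _)); apply/bigmax_leqP => j _.
  by rewrite size_polyXn ltnS leq_exp2l // mul1n -ltnS prednK.
have := @max_poly_roots _ P [seq val x | x : fixed_subfield pF k] P0.
rewrite size_map -cardE (card_fixed_subfield pF k_gt0 cardF kl).
move=> H; have : (p ^ k < (p ^ k.-1).+1)%N.
  apply: leq_trans szP; apply: H.
    apply/allP => _ /mapP[x _ ->]; have := all0 x; rewrite negbK rootE.
    by rewrite /P horner_sum; under eq_bigr do rewrite hornerXn.
  by rewrite map_inj_uniq ?enum_uniq //; apply: val_inj.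
by rewrite ltnS leq_exp2l // -{1}(prednK k_gt0) ltnn.
Qed.

Definition trace_char (x : fixed_subfield pF k) : algC :=
  prime_field_char zeta (frob_sum p 1 k (val x)).

Lemma frob_sum_prime (x : fixed_subfield pF k) :
  frob_sum p 1 k (val x) ^+ p = frob_sum p 1 k (val x).
Proof. by apply: frob_sum_fixed; rewrite mul1n fixed_subfieldP. Qed.

Lemma trace_charD : {morph trace_char : x y / x + y >-> x * y}.
Proof.
move=> x y; rewrite /trace_char rmorphD frob_sumD /=.
by rewrite prime_field_charD ?frob_sum_prime.
Qed.

Lemma trace_char_expp x : trace_char x ^+ p = 1.
Proof. exact: prime_field_char_expp. Qed.

Lemma trace_char_frob x : trace_char (x ^+ p) = trace_char x.
Proof.
by rewrite /trace_char -[in RHS]frob_sum_prime rmorphXn /= frob_sum_exp.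
Qed.

Lemma trace_char_nontriv : exists z, trace_char z != 1.
Proof.
have [z z0] := exists_frob_sum_neq0; exists z.
by rewrite /trace_char prime_field_char_eq1 // frob_sum_prime.
Qed.

End TraceChar.

End FrobeniusSum.

(** * From power sums to the number of solutions *)

Section Counting.

Variables (F : finFieldType) (p n : nat) (zeta : algC).
Hypotheses (pF : p \in [pchar F]) (p_odd : odd p) (n_gt0 : (0 < n)%N).
Hypotheses (cardF : #|F| = (p ^ (2 * n))%N) (zetaP : p.-primitive_root zeta).

Definition full_char (y : F) : algC :=
  prime_field_char p zeta (frob_sum p 1 (2 * n) y).

Let n2_gt0 : (0 < 2 * n)%N. Proof. by rewrite muln_gt0. Qed.

Let fixedF (x : F) : x \in frob_fixed pF (2 * n).
Proof. by rewrite unfold_in -cardF expf_card. Qed.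

(** [F] is its own fixed subfield at level [2 * n], so the results on trace characters of subfields
    apply to [F] itself. *)
Let full (x : F) : fixed_subfield pF (2 * n) := exist _ x (fixedF x).

Lemma full_char_trace y : full_char y = trace_char zeta (full y).
Proof. by []. Qed.

Lemma full_charD : {morph full_char : x y / x + y >-> x * y}.
Proof.
by move=> x y; rewrite !full_char_trace -trace_charD.
Qed.

Lemma full_char0 : full_char 0 = 1.
Proof.
rewrite /full_char /frob_sum big1 => [|j _].
  exact: (prime_field_char_natr pF zetaP 0).
by rewrite expr0n expn_eq0 eqn0Ngt (prime_gt0 (pcharf_prime pF)).
Qed.

Lemma sum_full_char_mul (y : F) :
  \sum_c full_char (y * c) = if y == 0 then #|F|%:R else 0.
Proof.
transitivity (\sum_(c | c ^+ (p ^ (2 * n)) == c) full_char (y * c)).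
  by apply: eq_bigl => c; rewrite -cardF expf_card eqxx.
rewrite (big_fixed_subfield pF).
rewrite (eq_bigr (fun c => trace_char zeta (full y * c))) //.
rewrite (@sum_psi_mul _ p (@trace_char _ _ pF zeta (2 * n))).
- by rewrite (card_fixed_subfield pF n2_gt0 cardF (dvdnn _)) -cardF.
- exact: pchar_fixed_subfield.
- exact: trace_charD.
- exact: trace_char_expp.
- exact: (trace_char_nontriv pF zetaP n2_gt0 cardF (dvdnn _)).
Qed.

Lemma sum_full_char_Delta (a c : F) (d t r : nat) :
  (0 < t)%N -> (t %| n)%N -> (0 < d)%N -> (r %| t)%N -> (d %| (p ^ r).+1)%N ->
  \sum_(x | x ^+ (p ^ (2 * t)) == x) full_char (c * (a * x ^+ d)) =
  (p ^ t)%:R * (Delta p n a d t r c)%:~R.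
Proof.
move=> t0 tn d0 rt dr.
have t20 : (0 < 2 * t)%N by rewrite muln_gt0.
have t2n : (2 * t %| 2 * n)%N by rewrite dvdn_pmul2l.
have n2E : (2 * n = 2 * t * (n %/ t))%N by rewrite -mulnA [(t * _)%N]mulnC divnK.
set T := rtrace p n t (c * a).
have TE : T = frob_sum p (2 * t) (n %/ t) (c * a) by [].
have Tfix : T \in frob_fixed pF (2 * t).
  rewrite unfold_in TE frob_sum_fixed // -n2E -cardF.
  exact: expf_card.
pose T' : fixed_subfield pF (2 * t) := exist _ T Tfix.
have cardK := card_fixed_subfield pF t20 cardF t2n.
have pK := pchar_fixed_subfield pF (2 * t).
have pD := @trace_charD _ _ pF zeta zetaP (2 * t).
have p1 := @trace_char_expp _ _ pF zeta zetaP (2 * t).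
have pf := @trace_char_frob _ _ pF zeta (2 * t).
have pn := trace_char_nontriv pF zetaP t20 cardF t2n.
rewrite (big_fixed_subfield pF).
(* The trace of [F] factors through the subfield, and [x ^+ d], lying in the subfield, comes out of
   the relative trace, leaving [T]. *)
transitivity (powersum (@trace_char _ _ pF zeta (2 * t)) d T').
  apply: eq_bigr => x _; rewrite /full_char /trace_char n2E -frob_sum_comp //.
  congr (prime_field_char _ _ (frob_sum _ _ _ _)).
  rewrite rmorphM rmorphXn /= mulrA [c * a * _]mulrC frob_sumZ //.
    by rewrite mulrC TE.
  by rewrite -exprM [(d * _)%N]mulnC exprM fixed_subfieldP.
(* If [T = 0], all [p^(2t)] terms are 1, which is [p^t] times the first value of [Delta]. *)
rewrite /Delta -/T; have [T0|T0] := eqVneq T 0.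
  have T'0 : T' = 0 by apply: val_inj.
  rewrite /powersum T'0 (eq_bigr (fun=> 1)) => [|x _].
    by rewrite sumr_const cardK mul2n -addnn expnD natrM.
  by rewrite mul0r (psi_0 pK pD p1).
have T'0 : T' != 0 by rewrite -(inj_eq val_inj).
have r0 : (0 < r)%N by apply: dvdn_gt0 rt.
(* The power sum formula is applied with [e = t / r], so that [Q = p^t]. *)
have cardK' : #|(fixed_subfield pF (2 * t) : finFieldType)| =
    (p ^ (2 * (r * (t %/ r))))%N by rewrite cardK [(r * _)%N]mulnC divnK.
rewrite (powersum_dvdE pK p_odd pD p1 pf pn r0 cardK' T'0 dr) cardK.
have -> : (T' ^+ ((p ^ (2 * t)).-1 %/ d) ==
             ((-1) ^+ (t %/ r)) ^+ ((p ^ r).+1 %/ d)) =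
          (T ^+ ((p ^ (2 * t)).-1 %/ d) ==
             ((-1) ^+ (t %/ r)) ^+ ((p ^ r).+1 %/ d)).
  by rewrite -(inj_eq val_inj) !rmorphXn.
rewrite [(r * _)%N]mulnC divnK //.
rewrite mulrAC mulrC; congr (_ * _).
case: ifP => _; rewrite ?muln0 ?muln1 ?subr0 ?mulr1.
  by rewrite rmorphM rmorphB /= rmorphXn rmorphN1 rmorph1.
by rewrite rmorphXn rmorphN1.
Qed.

Lemma card_solutions_Delta (s : nat) (a : 'I_s -> F) (t d r : 'I_s -> nat) :
  (forall i, 0 < t i /\ t i %| n)%N ->
  (forall i, 0 < d i /\ r i %| t i /\ d i %| (p ^ r i).+1)%N ->
  #|F|%:R * #|[set x : {ffun 'I_s -> F} |
       [forall i, x i ^+ (p ^ (2 * t i)) == x i] &&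
       (\sum_(i < s) a i * x i ^+ d i == 0)]|%:R =
  p%:R ^+ (\sum_(i < s) t i)%N *
    \sum_(c : F) \prod_(i < s) (Delta p n (a i) (d i) (t i) (r i) c)%:~R :> algC.
Proof.
move=> tP dP.
pose A (x : {ffun 'I_s -> F}) := \sum_(i < s) a i * x i ^+ d i.
pose Q i (y : F) := y ^+ (p ^ (2 * t i)) == y.
(* Orthogonality over [c] detects [A x = 0] with weight [#|F|]. *)
transitivity (\sum_(x in family Q) \sum_c full_char (A x * c)).
  under eq_bigr do rewrite sum_full_char_mul.
  rewrite -big_mkcondr sumr_const mulr_natr /=; congr (_ *+ _).
  by apply: eq_card => x; rewrite !inE.
rewrite exchange_big mulr_sumr /=; apply: eq_bigr => c _.
rewrite -prodrXr -big_split /=.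
rewrite (eq_bigr (fun i => \sum_(x | Q i x) full_char (c * (a i * x ^+ d i)))).
  (* Expanding the product of sums gives one sum over tuples, each coordinate in its own
     subfield. *)
  rewrite bigA_distr_big_dep /=; apply: eq_bigr => x _.
  rewrite mulrC mulr_sumr.
  exact: (big_morph _ full_charD full_char0).
move=> i _; have [t0 tn] := tP i; have [d0 [rt dr]] := dP i.
by rewrite /Q (sum_full_char_Delta _ _ t0 tn d0 rt dr) natrX.
Qed.

End Counting.

(** The exponent of [p] may be negative, so the identity is stated in [rat] with a quotient of
    powers. Membership of a coordinate in its subfield is expressed inside [F] by the Frobenius
    equation. *)
Theorem theorem1p2 (F : finFieldType) (p n s : nat)
  (a : 'I_s -> F) (t d r : 'I_s -> nat) :
  prime p -> odd p -> (0 < n)%N -> #|F| = (p ^ (2 * n))%N -> (1 <= s)%N ->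
  (forall i, 0 < t i /\ t i %| n)%N ->
  (forall i, 0 < d i /\ r i %| t i /\ d i %| (p ^ r i).+1)%N ->
  (#|[set x : {ffun 'I_s -> F} |
       [forall i, x i ^+ (p ^ (2 * t i)) == x i] &&
       (\sum_(i < s) a i * x i ^+ d i == 0)]|%:R : rat)
  = (p%:R ^+ (\sum_(i < s) t i)%N / p%:R ^+ (2 * n)) *
    \sum_(c : F) \prod_(i < s) (Delta p n (a i) (d i) (t i) (r i) c)%:~R.
Proof.
move=> p_pr p_odd n0 cardF _ tP dP.
have pF := card_finPcharP cardF p_pr.
have [zeta zetaP] := C_prim_root_exists (prime_gt0 p_pr).
have p0 : (p%:R : rat) ^+ (2 * n) != 0.
  by rewrite expf_neq0 // pnatr_eq0 -lt0n prime_gt0.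
rewrite mulrAC; apply: (mulIf p0); rewrite divfK //.
have := card_solutions_Delta pF p_odd n0 cardF zetaP a tP dP.
(* The embedding of [rat] in [algC] is injective, so the identity can be checked where the
   characters take their values. *)
set c := #|_| => E; apply: (fmorph_inj (ratr : rat -> algC)).
rewrite mulrC -natrX -cardF !rmorphM rmorphXn /= !ratr_nat E; congr (_ * _).
rewrite rmorph_sum; apply: eq_bigr => x _ /=.
by rewrite rmorph_prod; apply: eq_bigr => i _ /=; rewrite ratr_int.
Qed.
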